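(* (Non-Commutative Multiply Criterion.) Let $G=\{g_1,\dots,g_s\}\subseteq K\langle X\rangle\setminus\{0\}$ be the current set of polynomials in an execution of the Buchberger Procedure, at a moment when the new element $g_s$ has just been appended in step (B4). Let $i,j\in\{1,\dots,s\}$ and let ${\rm o}_{i,s}(w_i,w'_i;u_s,u'_s)\in{\rm NTObs}(i,s)$ and ${\rm o}_{j,s}(w_j,w'_j;v_s,v'_s)\in{\rm NTObs}(j,s)$ be two distinct non-trivial obstructions for which there exist words $w,w'\in\langle X\rangle$ with $u_s=wv_s$ and $u'_s=v'_sw'$. If $ww'\neq 1$, then the obstruction ${\rm o}_{i,s}(w_i,w'_i;u_s,u'_s)$ can be removed from $\bigcup_{1\le k\le s}{\rm NTObs}(k,s)$ in the execution of the Buchberger Procedure; that is, if in this pass through step (B4) the set $\bigcup_{1\le k\le s}{\rm NTObs}(k,s)\setminus\{{\rm o}_{i,s}(w_i,w'_i;u_s,u'_s)\}$ is appended to $B$ instead of $\bigcup_{1\le k\le s}{\rm NTObs}(k,s)$, then the procedure still enumerates a $\sigma$-Gröbner basis of $I$, and it still stops after finitely many steps with a finite $\sigma$-Gröbner basis of $I$ whenever $I$ has a finite $\sigma$-Gröbner basis.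
   Context: Basic notation. $K$ is a field, $X=\{x_1,\dots,x_n\}$ a finite alphabet, $\langle X\rangle$ the monoid of words in $X$ (product is concatenation, empty word is $1$), and $K\langle X\rangle$ the free associative $K$-algebra. A word ordering is a (total) well-ordering $\sigma$ on $\langle X\rangle$ such that $w_1\ge_\sigma w_2$ implies $w_3w_1w_4\ge_\sigma w_3w_2w_4$ for all words; $\sigma$ is a fixed word ordering. For $f\ne0$, ${\rm Lw}_\sigma(f)$ is the $\sigma$-largest word in the support of $f$ and ${\rm Lc}_\sigma(f)$ its coefficient. A subset $G$ of a two-sided ideal $I$ is a $\sigma$-Gröbner basis of $I$ if $\{{\rm Lw}_\sigma(g)\mid g\in G\setminus\{0\}\}$ generates the two-sided ideal $\langle {\rm Lw}_\sigma(f)\mid f\in I\setminus\{0\}\rangle$. Obstructions. For $G=\{g_1,\dots,g_s\}\subseteq K\langle X\rangle\setminus\{0\}$ let $F_s=(K\langle X\rangle\otimes_KK\langle X\rangle)^s$ be the free two-sided module with canonical basis $e_1,\dots,e_s$. If words satisfy $w_i{\rm Lw}_\sigma(g_i)w'_i=w_j{\rm Lw}_\sigma(g_j)w'_j$, then ${\rm o}_{i,j}(w_i,w'_i;w_j,w'_j)=\frac1{{\rm Lc}_\sigma(g_i)}w_ie_iw'_i-\frac1{{\rm Lc}_\sigma(g_j)}w_je_jw'_j\in F_s$, whenever non-zero, is called an obstruction of $g_i$ and $g_j$; its S-polynomial is $S_{i,j}(w_i,w'_i;w_j,w'_j)=\frac1{{\rm Lc}_\sigma(g_i)}w_ig_iw'_i-\frac1{{\rm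 Lc}_\sigma(g_j)}w_jg_jw'_j$. The obstruction has an overlap if the indicated occurrences of ${\rm Lw}_\sigma(g_i)$ and ${\rm Lw}_\sigma(g_j)$ in the word $w_i{\rm Lw}_\sigma(g_i)w'_i=w_j{\rm Lw}_\sigma(g_j)w'_j$ overlap in a non-empty word (share a letter position); otherwise it has no overlap. For $i\ne j$, an obstruction of $g_i,g_j$ is non-trivial if it has an overlap and is of one of the forms ${\rm o}_{i,j}(w_i,1;1,w'_j)$, ${\rm o}_{i,j}(1,w'_i;w_j,1)$, ${\rm o}_{i,j}(w_i,w'_i;1,1)$, ${\rm o}_{i,j}(1,1;w_j,w'_j)$; an obstruction of $g_i$ with itself is non-trivial if it has an overlap and is of the form ${\rm o}_{i,i}(1,w'_i;w_i,1)$ with $w_i,w'_i\ne1$. ${\rm NTObs}(i,j)$ is the set of non-trivial obstructions of $g_i$ and $g_j$. Normal remainder. ${\rm NR}_{\sigma,G}(f)$ is any polynomial $p$ produced by the division algorithm: start with $p=0$, $v=f$; while $v\ne0$: if ${\rm Lw}_\sigma(v)=w\,{\rm Lw}_\sigma(g_i)w'$ for some $i$ (take the smallest such $i$) and words $w,w'$, replace $v$ by $v-\frac{{\rm Lc}_\sigma(v)}{{\rm Lc}_\sigma(g_i)}wg_iw'$; otherwise move the leading monomial of $v$ from $v$ to $p$. Buchberger Procedure. Input: $s\ge1$ and a set $G=\{g_1,\dots,g_s\}$ of non-zero polynomials generating the two-sided ideal $I$. (B1) Let $B=\bigcup_{1\le i\le j\le s}{\rm NTObs}(i,j)$. (B2)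 If $B=\emptyset$, return $G$. Otherwise select an obstruction in $B$ using a fair strategy (one which ensures that every obstruction is selected eventually) and delete it from $B$. (B3) Compute its S-polynomial $S$ and $S'={\rm NR}_{\sigma,G}(S)$; if $S'=0$ go to (B2). (B4) Increase $s$ by one, append $g_s=S'$ to $G$, append $\bigcup_{1\le i\le s}{\rm NTObs}(i,s)$ to $B$, and go to (B2). The procedure ''enumerates a $\sigma$-Gröbner basis of $I$'' if the set of all polynomials which are in $G$ at some stage is a $\sigma$-Gröbner basis of $I$. *)

(* Defs.v *)
From mathcomp Require Import all_boot all_order all_algebra.
From mathcomp Require Import finmap boolp classical_sets.
From mathcomp Require Import monalg.

Set Implicit Arguments.
Unset Strict Implicit.
Unset Printing Implicit Defensive.

Import GRing.Theory.

Local Open Scope classical_set_scope.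
Local Open Scope ring_scope.

Notation "u * v" := (mmul u v) : monom_scope.

Notation word n := {fmonom 'I_n}.
Notation freealg K n := {malg K[word n]}.

(* The K-basis of (K<X> (x) K<X>)^s is formed by the elements w e_i w'; the    *)
(* index i ranges over nat, so that all the modules F_s, with s increasing     *)
(* during the procedure, are contained in one another.                        *)
Notation freebimod K n := {malg K[(word n * nat * word n)%type]}.

Record word_ordering (n : nat) := WordOrdering {
  wle :> rel (word n);
  wle_refl : reflexive wle;
  wle_anti : antisymmetric wle;
  wle_trans : transitive wle;
  wle_total : total wle;
  wlt_wf : well_founded (fun v w : word n => wle v w && (v != w));
  wle_mul : forall w1 w2 w3 w4 : word n,
    wle w2 w1 -> wle (w3 * w2 * w4)%M (w3 * w1 * w4)%M
}.

Section Buchberger.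

Variables (K : fieldType) (n : nat) (sigma : word_ordering n).

Local Notation W := (word n).
Local Notation A := (freealg K n).
Local Notation F := (freebimod K n).

Implicit Types (f g p v r : A) (G : seq A) (w u : W) (i j k : nat).

(* Meaningful only for f != 0; Lw 0 is the empty word. *)
Definition Lw f : W := last mone (sort sigma (msupp f)).

Definition Lc f : K := f@_(Lw f).

Lemma LwP f : f != 0 ->
  Lw f \in msupp f /\ {in msupp f, forall w, sigma w (Lw f)}.
Proof.
move=> f0; rewrite /Lw.
have /(_ _)/esym memE : sort sigma (msupp f) =i msupp f by exact: mem_sort.
have srt : sorted sigma (sort sigma (msupp f)).
  by apply: sort_sorted; exact: wle_total.
have : sort sigma (msupp f) != [::].
  apply: contra f0 => /eqP s0; apply/eqP/malgP => w; rewrite mcoeff0.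
  by apply: mcoeff_outdom; rewrite memE s0.
case/lastP: (sort _ _) srt memE => // s x srt memE _; rewrite last_rcons.
split=> [|w]; rewrite memE mem_rcons inE ?eqxx // => /orP[/eqP ->|ws].
  exact: wle_refl.
move: srt; rewrite -cats1 sorted_pairwise; last exact: wle_trans.
by rewrite pairwise_cat allrel1r => /and3P[/allP/(_ _ ws)].
Qed.

Definition ideal_gen (S : set A) : set A :=
  [set f | exists2 t : seq (A * A * A), (forall x, x \in t -> S x.1.2) &
    f = \sum_(x <- t) x.1.1 * x.1.2 * x.2].

Definition groebner_basis (I G : set A) : Prop :=
  G `<=` I /\
  ideal_gen [set << Lw g >> | g in G `\ 0] =
  ideal_gen [set << Lw f >> | f in I `\ 0].

(* Indices start at 0: the polynomials g_1, ..., g_s are G`_0, ..., G`_(s - 1). *)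
Definition obs G i j (wi wi' wj wj' : W) : F :=
  (Lc G`_i)^-1 *: << (wi, i, wi') >> - (Lc G`_j)^-1 *: << (wj, j, wj') >>.

Definition is_obs G i j (wi wi' wj wj' : W) : Prop :=
  [/\ (i < size G)%N, (j < size G)%N,
      (wi * Lw G`_i * wi' = wj * Lw G`_j * wj')%M
    & obs G i j wi wi' wj wj' != 0].

Definition Spoly G i j (wi wi' wj wj' : W) : A :=
  (Lc G`_i)^-1 *: (<< wi >> * G`_i * << wi' >>)
    - (Lc G`_j)^-1 *: (<< wj >> * G`_j * << wj' >>).

Definition overlap G i j (wi wj : W) : Prop :=
  exists q : nat, (fdeg wi <= q < fdeg wi + fdeg (Lw G`_i))%N /\
                  (fdeg wj <= q < fdeg wj + fdeg (Lw G`_j))%N.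

Definition nontrivial G i j (wi wi' wj wj' : W) : Prop :=
  [/\ is_obs G i j wi wi' wj wj', overlap G i j wi wj &
    if i == j then [/\ wi = mone, wj' = mone, wi' != mone & wj != mone]
    else [\/ wi' = mone /\ wj = mone, wi = mone /\ wj' = mone,
             wj = mone /\ wj' = mone | wi = mone /\ wi' = mone]].

Definition NTObs G i j : set F :=
  [set o | exists wi wi' wj wj', nontrivial G i j wi wi' wj wj' /\
                                 o = obs G i j wi wi' wj wj'].

Definition Lw_divides g (w u u' : W) : Prop := (w = u * Lw g * u')%M.

(* division G v p r: from the current values of v and p, the division         *)
(* algorithm by G can end with the normal remainder r.                        *)
Inductive division G : A -> A -> A -> Prop :=
| DivisionEnd p : division G 0 p p
| DivisionReduce v p r i (w w' : W) of
    v != 0 & (i < size G)%N & Lw_divides G`_i (Lw v) w w' &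
    (forall k u u', (k < i)%N -> ~ Lw_divides G`_k (Lw v) u u') &
    division G (v - (Lc v / Lc G`_i) *: (<< w >> * G`_i * << w' >>)) p r :
  division G v p r
| DivisionMove v p r of
    v != 0 &
    (forall k u u', (k < size G)%N -> ~ Lw_divides G`_k (Lw v) u u') &
    division G (v - Lc v *: << Lw v >>) (p + Lc v *: << Lw v >>) r :
  division G v p r.

Definition is_NR G f r : Prop := division G f 0 r.

(* The values of G and B each time the procedure tests whether B is empty. *)
Record state := State { stG : seq A; stB : set F }.

Definition initial_obs G : set F :=
  [set o | exists i j, (i <= j < size G)%N /\ NTObs G i j o].

(* The last element of G is the one which was just appended. *)
Definition new_obs G : set F :=
  [set o | exists2 k, (k < size G)%N & NTObs G k (size G).-1 o].

(* One pass through the loop, in which o is selected. If the normal remainder  *)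
(* is not zero, N G' is the set appended to B, where G' is the enlarged G; the *)
(* unmodified procedure has N = new_obs.                                      *)
Definition pass (N : seq A -> set F) (st : state) (o : F) (st' : state) :=
  stB st o /\
  exists i j wi wi' wj wj' r,
    [/\ is_obs (stG st) i j wi wi' wj wj',
        o = obs (stG st) i j wi wi' wj wj',
        is_NR (stG st) (Spoly (stG st) i j wi wi' wj wj') r
      & st' = if r == 0 then State (stG st) (stB st `\ o)
              else State (rcons (stG st) r)
                         ((stB st `\ o) `|` N (rcons (stG st) r))].

(* A finite execution is prolonged by repeating its last state. The set N may  *)
(* depend on the pass; sel t is the obstruction selected in pass t.            *)
Definition execution (N : nat -> seq A -> set F) (G0 : seq A)
    (st : nat -> state) (sel : nat -> F) : Prop :=
  st 0%N = State G0 (initial_obs G0) /\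
  forall t, (stB (st t) = set0 /\ st t.+1 = st t) \/
            pass (N t) (st t) (sel t) (st t.+1).

Definition fair (st : nat -> state) (sel : nat -> F) : Prop :=
  forall t o, stB (st t) o ->
    exists2 t', (t <= t')%N & stB (st t') o /\ sel t' = o.

Definition enumerated (st : nat -> state) : set A :=
  [set g | exists t, g \in stG (st t)].

(* The unmodified procedure, except that in pass t0 the obstruction o is not     *)
(* appended to B.                                                             *)
Definition new_obs_without (t0 : nat) (o : F) (t : nat) (G : seq A) : set F :=
  if t == t0 then new_obs G `\ o else new_obs G.

End Buchberger.

(* Main.v *)
(* S-polynomials of all pairs of occurrences of leading words are representable  *)
(* by multiples of elements of G with smaller leading words: this is inherited   *)
(* by multiples and by sums of obstructions, is clear without overlap, and for a *)
(* nontrivial obstruction follows from its being selected. The obstruction       *)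
(* o_{i,s} left out is the sum of an obstruction of g_i and g_j and of           *)
(* w o_{j,s} w'. The second was queued; the first is a multiple of a nontrivial  *)
(* obstruction, and the latter cannot be o_{i,s} itself. Hence Buchberger's      *)
(* criterion applies to the set of all polynomials enumerated. If I has a finite *)
(* Groebner basis, some stage of G is already one, after which every normal      *)
(* remainder is 0 and the finite set B only shrinks.                             *)

Require Import Defs.
From mathcomp Require Import all_boot all_order all_algebra zify.
From mathcomp Require Import finmap boolp classical_sets.
From mathcomp Require Import monalg.

Set Implicit Arguments.
Unset Strict Implicit.
Unset Printing Implicit Defensive.

Import GRing.Theory.

Local Open Scope classical_set_scope.
Local Open Scope ring_scope.

(** The engine is Buchberger's criterion, [lrep_Lw_divides]. Suppose that whenever two multiples of
    members of a set have the same leading word [w], the difference of their monic versions is a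
    combination of multiples with leading words below [w]. Then terms sharing the top leading word
    can be merged, and well-founded descent shows that the leading word of every nonzero ideal
    element is divisible by that of a member. The criterion is applied to the set of all enumerated
    polynomials; each pair is compared at a finite stage containing both. Representability of an
    obstruction ([obs_lrep]) is stable under multiples, reversal and composition, and it holds
    without overlap ([lrep_disjoint]), so [obs_lrep_reduce] leaves only nontrivial obstructions. A
    queued one is selected by fairness, and division together with the appended remainder represents
    its S-polynomial ([stB_obs_lrep]). For the omitted [o], [removed_obs_lrep] passes from g_i to
    g_s through w g_j w'. This is not circular: if the step from g_i to g_j came from [o] itself,
    equality of leading words would make the multiplier trivial, and then either that step is
    between equal terms or o_{j,s} is zero. Termination combines [stG_groebner] with the finiteness
    of B ([groebner_stop]). *)

Section Words.

(** * Cancellation and factorization in the word monoid *)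

Variable n : nat.
Implicit Types a b c d u v w : word n.

Lemma word_inj u v : u = v :> seq 'I_n -> u = v.
Proof. by move=> uv; apply/eqP; rewrite fmP uv. Qed.

Lemma mmulI a u v : (a * u = a * v)%M -> u = v.
Proof.
move=> /(congr1 (@fmonom_val _)); rewrite !fmM => /eqP.
by rewrite eqseq_cat // eqxx => /eqP /word_inj.
Qed.

Lemma mmulIr b u v : (u * b = v * b)%M -> u = v.
Proof.
move=> /(congr1 (@fmonom_val _)); rewrite !fmM => uv; move: (congr1 size uv).
rewrite !size_cat => /addIn suv; move/eqP: uv.
by rewrite eqseq_cat // eqxx andbT => /eqP /word_inj.
Qed.

Lemma fdeg_id_mul a u b : (a * u * b = u)%M -> a = mone /\ b = mone.
Proof.
move=> /(congr1 (@fdeg _)); rewrite !fdegM => e.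
suff /andP[/eqP ea /eqP eb] : (fdeg a == 0%N) && (fdeg b == 0%N).
  by split; exact: fdeg_eq0I.
rewrite -addn_eq0; apply/eqP/(@addnI (fdeg u)).
by rewrite addn0 -{2}e addnA (addnC (fdeg u)).
Qed.

Lemma mmul_prefix a u a' u' : (a * u = a' * u')%M -> (fdeg a <= fdeg a')%N ->
  exists2 p, a' = (a * p)%M & u = (p * u')%M.
Proof.
move=> e le; have ea : a' = (a * FMonom (drop (fdeg a) a'))%M.
  apply: word_inj; rewrite fmM /=; move/(congr1 (@fmonom_val _)): e.
  rewrite !fmM => e; rewrite -{1}(cat_take_drop (fdeg a) a'); congr (_ ++ _).
  have := congr1 (take (fdeg a)) e.
  by rewrite take_size_cat // takel_cat.
eexists; first exact: ea.
by apply: (@mmulI a); rewrite e {1}ea mulmA.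
Qed.

Lemma mmul_suffix u b u' b' : (u * b = u' * b')%M -> (fdeg b <= fdeg b')%N ->
  exists2 q, b' = (q * b)%M & u = (u' * q)%M.
Proof.
move=> e le; have le' : (fdeg u' <= fdeg u)%N.
  have := congr1 (@fdeg _) e; rewrite !fdegM => e'.
  by rewrite -(leq_add2r (fdeg b')) -e' leq_add2l.
by have [q -> eq] := mmul_prefix (esym e) le'; exists q.
Qed.

(** Strips the common right context of an obstruction, so that one right cofactor becomes empty, as
    the nontrivial forms demand. *)
Lemma suffix_reduce u b u' b' : (u * b = u' * b')%M ->
  exists d b0 b0', [/\ b = (b0 * d)%M, b' = (b0' * d)%M &
    b0 = mone \/ b0' = mone].
Proof.
move=> e; have [le|/ltnW le] := leqP (fdeg b) (fdeg b').
  have [p eb _] := mmul_suffix e le; exists b, mone, p.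
  by split; [rewrite mul1m|exact: eb|left].
have [p eb _] := mmul_suffix (esym e) le; exists b', p, mone.
by split; [exact: eb|rewrite mul1m|right].
Qed.

End Words.

(** * Two-sided multiples by words in a monoid algebra *)

Lemma mulr_exchange (R : pzRingType) (a b d f g u v : R) :
  a * f * (b * v * d) - a * u * b * g * d =
  a * (f - u) * (b * g * d) - a * f * b * (g - v) * d.
Proof.
by rewrite !(mulrBr, mulrBl) !mulrA [RHS]addrC opprB addrA subrK.
Qed.

Section Sandwich.

Variables (M : monomType) (K : comNzRingType).
Local Notation A := {malg K[M]}.
Implicit Types (f g h : A) (a b u v w : M) (c : K).

Definition sandwich a f b : A := << a >> * f * << b >>.

Lemma malgUZ c u : << c *g u >> = c *: << u >> :> A.
Proof. by rewrite -mul_malgC malgM_def fgmulUU mulr1 mul1m. Qed.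

Lemma malg_scaleAr c f g : f * (c *: g) = c *: (f * g).
Proof.
rewrite -!mul_malgC mulrA [in RHS]mulrA; congr (_ * _).
rewrite [f]monalgE mulr_suml mulr_sumr; apply: eq_bigr => u _.
by rewrite !malgM_def !fgmulUU mulm1 mul1m mulrC.
Qed.

Lemma malgUM u v : << u >> * << v >> = << (u * v)%M >> :> A.
Proof. by rewrite malgM_def fgmulUU mulr1. Qed.

Lemma malg_sum f : f = \sum_(u <- msupp f) f@_u *: << u >>.
Proof. by rewrite {1}[f]monalgE; apply: eq_bigr => u _; rewrite malgUZ. Qed.

Lemma malg_mul_sum f g h : f * g * h = \sum_(u <- msupp g) g@_u *: (f * << u >> * h).
Proof.
rewrite [in LHS](malg_sum g) mulr_sumr mulr_suml; apply: eq_bigr => u _.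
by rewrite malg_scaleAr -fgscaleAl.
Qed.

Lemma malg_sandwich_sum f g h : f * g * h =
  \sum_(u <- msupp f) \sum_(v <- msupp h) (f@_u * h@_v) *: sandwich u g v.
Proof.
rewrite -mulrA -[f in LHS]mul1r malg_mul_sum; apply: eq_bigr => u _.
rewrite mul1r mulrA -[LHS]mulr1 -fgscaleAl malg_mul_sum scaler_sumr.
by apply: eq_bigr => v _; rewrite mulr1 scalerA.
Qed.

Lemma sandwich0 a b : sandwich a 0 b = 0.
Proof. by rewrite /sandwich mulr0 mul0r. Qed.

Lemma sandwichD a f g b : sandwich a (f + g) b = sandwich a f b + sandwich a g b.
Proof. by rewrite /sandwich mulrDr mulrDl. Qed.

Lemma sandwichN a f b : sandwich a (- f) b = - sandwich a f b.
Proof. by rewrite /sandwich mulrN mulNr. Qed.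

Lemma sandwichB a f g b : sandwich a (f - g) b = sandwich a f b - sandwich a g b.
Proof. by rewrite sandwichD sandwichN. Qed.

Lemma sandwichZ a c f b : sandwich a (c *: f) b = c *: sandwich a f b.
Proof. by rewrite /sandwich malg_scaleAr -fgscaleAl. Qed.

Lemma sandwichU a u b : sandwich a << u >> b = << (a * u * b)%M >>.
Proof. by rewrite /sandwich !malgUM. Qed.

Lemma sandwichA a a' f b' b :
  sandwich a (sandwich a' f b') b = sandwich (a * a')%M f (b' * b)%M.
Proof. by rewrite /sandwich -!malgUM !mulrA. Qed.

Lemma sandwich1 f : sandwich mone f mone = f.
Proof. by rewrite /sandwich mul1r mulr1. Qed.

(** For [u], [v] the leading words of monic [f], [g], the left side is the S-polynomial of two
    disjoint occurrences. Each product on the right contains a tail [f - << u >>] or [g - << v >>],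
    which lowers the leading words. *)
Lemma sandwich_exchange a b d u v f g :
  sandwich a f (b * v * d)%M - sandwich (a * u * b)%M g d =
  << a >> * (f - << u >>) * sandwich b g d -
  sandwich a f b * (g - << v >>) * << d >>.
Proof.
have wE x y z : << (x * y * z)%M >> = << x >> * << y >> * << z >> :> A.
  by rewrite !malgUM.
by rewrite /sandwich !wE; exact: mulr_exchange.
Qed.

Lemma sandwich_wordl a b d u g :
  << a >> * << u >> * sandwich b g d = sandwich (a * u * b)%M g d.
Proof. by rewrite /sandwich -!malgUM !mulrA. Qed.

Lemma sandwich_wordr a b d u g :
  sandwich a g b * << u >> * << d >> = sandwich a g (b * u * d)%M.
Proof. by rewrite /sandwich -!malgUM !mulrA. Qed.

Lemma msupp_sandwich a f b w : w \in msupp (sandwich a f b) ->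
  exists2 u, u \in msupp f & w = (a * u * b)%M.
Proof.
move=> /msuppM_le[k1 [k2 []]] /msuppM_le[k3 [k4 []]].
rewrite !msuppU1 !inE => /eqP -> k4f -> /eqP -> ->; by exists k4.
Qed.

End Sandwich.

(** * Standard representations, Buchberger's criterion and division *)

Section Representations.

Variables (K : fieldType) (n : nat) (sigma : word_ordering n).
Local Notation A := (freealg K n).
Local Notation W := (word n).
Local Notation Lw := (Lw sigma).
Local Notation Lc := (Lc sigma).
Implicit Types (f g h r : A) (a b u v w : W) (c : K) (GG : set A).

Definition slt u v := sigma u v && (u != v).

Lemma le_slt_trans u v w : sigma u v -> slt v w -> slt u w.
Proof.
move=> uv /andP[vw nvw]; apply/andP; split; first exact: wle_trans vw.
apply: contra nvw => /eqP uw; apply/eqP/(wle_anti (w := sigma)).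
by rewrite vw -uw.
Qed.

Lemma sltW u v : slt u v -> sigma u v.
Proof. by case/andP. Qed.

Lemma slt_irr u : slt u u = false.
Proof. by rewrite /slt eqxx andbF. Qed.

Lemma slt_total u v : [\/ slt u v, u = v | slt v u].
Proof.
have [->|nuv] := eqVneq u v; first by constructor 2.
have := wle_total sigma u v; case/orP => h; [constructor 1|constructor 3].
  by rewrite /slt h.
by rewrite /slt h eq_sym.
Qed.

Lemma slt_mul a b u v : slt u v -> slt (a * u * b)%M (a * v * b)%M.
Proof.
move=> /andP[uv nuv]; apply/andP; split; first exact: wle_mul.
by apply: contra nuv => /eqP /mmulIr /mmulI ->.
Qed.

Lemma Lw_supp f : f != 0 -> Lw f \in msupp f.
Proof. by move=> /(LwP sigma)[]. Qed.

Lemma Lw_max f u : u \in msupp f -> sigma u (Lw f).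
Proof.
move=> uf; have f0 : f != 0 by apply: contraTneq uf => ->; rewrite msupp0 inE.
by have [_] := LwP sigma f0; apply.
Qed.

Lemma Lc_neq0 f : f != 0 -> Lc f != 0.
Proof. by move=> f0; rewrite mcoeff_neq0 Lw_supp. Qed.

Definition within (P : W -> Prop) f := forall u, u \in msupp f -> P u.

Notation below w := (within (slt^~ w)).

Lemma within0 P : within P 0.
Proof. by move=> u; rewrite msupp0 inE. Qed.

Lemma withinD P f g : within P f -> within P g -> within P (f + g).
Proof.
move=> Pf Pg u /(fsubsetP (msuppD_le _ _)); rewrite inE => /orP[].
  exact: Pf.
exact: Pg.
Qed.

Lemma withinN P f : within P f -> within P (- f).
Proof. by move=> Pf u; rewrite msuppN; exact: Pf. Qed.

Lemma withinB P f g : within P f -> within P g -> within P (f - g).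
Proof. by move=> Pf Pg; apply: withinD => //; exact: withinN. Qed.

Lemma withinZ P c f : within P f -> within P (c *: f).
Proof. by move=> Pf u /(fsubsetP (msuppZ_le _ _)); exact: Pf. Qed.

Lemma withinU (P : W -> Prop) u : P u -> within P << u >>.
Proof. by move=> Pu v; rewrite msuppU1 inE => /eqP ->. Qed.

Lemma within_sandwich_Lw (P : W -> Prop) a g b :
    (forall u v, sigma u v -> P v -> P u) ->
  P (a * Lw g * b)%M -> within P (sandwich a g b).
Proof.
move=> Pdown Pg _ /msupp_sandwich[v vg ->]; apply: Pdown Pg.
by apply: wle_mul; exact: Lw_max.
Qed.

Lemma below_sandwich w a b f : below w f -> below (a * w * b)%M (sandwich a f b).
Proof. by move=> wf _ /msupp_sandwich[u /wf uw ->]; exact: slt_mul. Qed.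

(** For [g != 0] this is the leading word of [sandwich a g b], since the ordering is compatible with
    products. *)
Definition lead_word a g b := (a * Lw g * b)%M.

Definition monic_term a g b := (Lc g)^-1 *: sandwich a g b.

Lemma sandwich_monic_term a g b : g != 0 -> sandwich a g b = Lc g *: monic_term a g b.
Proof. by move=> g0; rewrite scalerA divff ?scale1r // Lc_neq0. Qed.

Lemma lead_word_sandwich a a' g b' b :
  lead_word (a * a')%M g (b' * b)%M = (a * lead_word a' g b' * b)%M.
Proof. by rewrite /lead_word !mulmA. Qed.

Lemma monic_term_sandwich a a' g b' b :
  monic_term (a * a')%M g (b' * b)%M = sandwich a (monic_term a' g b') b.
Proof. by rewrite sandwichZ sandwichA. Qed.

Lemma below_lead g : g != 0 -> below (Lw g) (g - Lc g *: << Lw g >>).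
Proof.
move=> g0 u; rewrite -mcoeff_neq0 => ug.
have nu : u != Lw g.
  by apply: contraNneq ug => ->; rewrite mcoeffB mcoeffZ mcoeffUU mulr1 subrr.
rewrite /slt nu andbT; apply: Lw_max; move: ug.
rewrite mcoeffB mcoeffZ mcoeffU (eq_sym (Lw g)) (negbTE nu).
by rewrite mulr0n mulr0 subr0 mcoeff_neq0.
Qed.

Lemma below_monic_term a g b : g != 0 ->
  below (lead_word a g b) (monic_term a g b - << lead_word a g b >>).
Proof.
move=> g0; have -> : monic_term a g b - << lead_word a g b >> =
    (Lc g)^-1 *: sandwich a (g - Lc g *: << Lw g >>) b.
  rewrite sandwichB sandwichZ sandwichU [RHS]scalerBr scalerA mulVf ?Lc_neq0 //.
  by rewrite scale1r.
by apply: withinZ; apply: below_sandwich; exact: below_lead.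
Qed.

(** Here [P] constrains the leading word of every term, not only that of the sum. A strict upper
    bound gives the representations of Buchberger's criterion; [anyw] gives membership in the
    two-sided ideal ([ideal_genE]). *)
Inductive lrep GG (P : W -> Prop) : A -> Prop :=
| lrep0 : lrep GG P 0
| lrepS c a g b f : GG g -> P (lead_word a g b) -> lrep GG P f ->
    lrep GG P (c *: sandwich a g b + f).

Section Lrep.

Variable GG : set A.
Implicit Types P Q : W -> Prop.

Lemma lrep_mono P Q f : (forall u, P u -> Q u) -> lrep GG P f -> lrep GG Q f.
Proof.
move=> PQ; elim=> [|c a g b {}f Gg Pg _ IH]; first exact: lrep0.
by apply: lrepS => //; exact: PQ.
Qed.

Lemma lrepD P f g : lrep GG P f -> lrep GG P g -> lrep GG P (f + g).
Proof.
move=> Pf Pg; elim: Pf => [|c a h b {}f Gh Ph _ IH]; first by rewrite add0r.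
by rewrite -addrA; exact: lrepS.
Qed.

Lemma lrepZ P c f : lrep GG P f -> lrep GG P (c *: f).
Proof.
elim=> [|d a h b {}f Gh Ph _ IH]; first by rewrite scaler0; exact: lrep0.
by rewrite scalerDr scalerA; exact: lrepS.
Qed.

Lemma lrepN P f : lrep GG P f -> lrep GG P (- f).
Proof. by rewrite -scaleN1r; exact: lrepZ. Qed.

Lemma lrepB P f g : lrep GG P f -> lrep GG P g -> lrep GG P (f - g).
Proof. by move=> Pf Pg; apply: lrepD => //; exact: lrepN. Qed.

Lemma lrep_sandwich1 P a g b : GG g -> P (lead_word a g b) ->
  lrep GG P (sandwich a g b).
Proof.
by move=> Gg Pg; rewrite -[sandwich _ _ _]scale1r -[_ *: _]addr0; apply: lrepS => //;
  exact: lrep0.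
Qed.

Lemma lrep_sum P (I : eqType) (s : seq I) (F : I -> A) :
  (forall i, i \in s -> lrep GG P (F i)) -> lrep GG P (\sum_(i <- s) F i).
Proof.
move=> h; rewrite big_seq; elim/big_rec: _ => [|i f /h]; first exact: lrep0.
exact: lrepD.
Qed.

Lemma lrep_sandwich P Q a b f : (forall u, P u -> Q (a * u * b)%M) ->
  lrep GG P f -> lrep GG Q (sandwich a f b).
Proof.
move=> PQ; elim=> [|c a' g b' {}f Gg Pg _ IH].
  by rewrite sandwich0; exact: lrep0.
rewrite sandwichD sandwichZ sandwichA; apply: lrepS => //.
by rewrite lead_word_sandwich; exact: PQ.
Qed.

Lemma lrep_below w f : lrep GG (slt^~ w) f -> below w f.
Proof.
elim=> [|c a g b {}f Gg Pg _ IH]; first exact: within0.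
apply: withinD => //; apply: withinZ; apply: within_sandwich_Lw Pg => u v.
exact: le_slt_trans.
Qed.

Hypothesis GG_neq0 : forall g, GG g -> g != 0.

Hypothesis GG_spoly : forall a g b a' h b', GG g -> GG h ->
  lead_word a g b = lead_word a' h b' ->
  lrep GG (slt^~ (lead_word a g b)) (monic_term a g b - monic_term a' h b').

(** Two top terms with equal leading word merge at the cost of an S-polynomial, which [GG_spoly]
    represents strictly below. The merged coefficient [c] may be zero. *)
Lemma lrep_collapse P f : lrep GG P f -> f = 0 \/
  exists c a g b r, [/\ GG g, P (lead_word a g b),
    f = c *: monic_term a g b + r & lrep GG (slt^~ (lead_word a g b)) r].
Proof.
elim=> [|c a g b {}f Gg Pg Pf IH]; first by left.
right; rewrite sandwich_monic_term ?GG_neq0 // scalerA.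
case: IH => [->|[c' [a' [h [b' [r [Gh Ph -> Pr]]]]]]].
  by exists (c * Lc g), a, g, b, 0; split=> //; exact: lrep0.
set m := monic_term a g b; set m' := monic_term a' h b'.
have [lt|e|lt] := slt_total (lead_word a g b) (lead_word a' h b').
- exists c', a', h, b', ((c * Lc g) *: m + r).
  split; [exact: Gh|exact: Ph|exact: addrCA|].
  by apply: lrepD => //; rewrite scalerA; apply: lrepZ; exact: lrep_sandwich1.
- exists (c * Lc g + c'), a, g, b, (r - c' *: (m - m')).
  split; [by []|by []| |].
    rewrite scalerDl scalerBr opprB -[in RHS]addrA; congr (_ + _).
    by rewrite [in RHS]addrC -[in RHS]addrA subrK addrC.
  by apply: lrepB; [rewrite e|apply: lrepZ; exact: GG_spoly].
- exists (c * Lc g), a, g, b, (c' *: m' + r); split; [by []|by []|by []|].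
  apply: lrepD; first by rewrite scalerA; apply: lrepZ; exact: lrep_sandwich1.
  by apply: lrep_mono Pr => u /sltW ulh; exact: le_slt_trans lt.
Qed.

(** Descent on the leading word of the top term. If its coefficient is zero, the remaining terms are
    a representation of [f] lying lower, which is collapsed again; otherwise nothing can cancel the
    top word. *)
Lemma lrep_Lw_divides P f : f != 0 -> lrep GG P f ->
  exists2 g, GG g & exists a b, Lw f = lead_word a g b.
Proof.
move=> f0 /lrep_collapse[fz|]; first by rewrite fz eqxx in f0.
move=> [c [a [g [b [r [Gg _ fE rP]]]]]].
move: {2}(lead_word a g b) (erefl (lead_word a g b)) => w cw.
elim/(well_founded_ind (wlt_wf sigma)): w => w IH in c a g b r Gg fE rP cw *.
have [c0|c0] := eqVneq c 0.
  move: fE; rewrite c0 scale0r add0r => fE; rewrite -fE in rP.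
  case: (lrep_collapse rP) => [fz|]; first by rewrite fz eqxx in f0.
  move=> [c' [a' [g' [b' [r' [Gg' lt fE' rP']]]]]].
  by apply: (IH (lead_word a' g' b') _ c' a' g' b' r') => //; rewrite -cw.
exists g => //; exists a, b.
have bf : below (lead_word a g b) (f - c *: << lead_word a g b >>).
  rewrite fE addrAC -scalerBr; apply: withinD; last exact: lrep_below.
  by apply: withinZ; apply: below_monic_term; exact: GG_neq0.
have fc : f@_(lead_word a g b) = c.
  have : (f - c *: << lead_word a g b >>)@_(lead_word a g b) = 0.
    by apply: mcoeff_outdom; apply/negP => /bf; rewrite slt_irr.
  by rewrite mcoeffB mcoeffZ mcoeffUU mulr1 => /subr0_eq.
apply: (wle_anti (w := sigma)); rewrite [X in _ && X]Lw_max ?andbT; last first.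
  by rewrite -mcoeff_neq0 fc.
have [->|ne] := eqVneq (Lw f) (lead_word a g b); first exact: wle_refl.
apply/sltW/bf; rewrite -mcoeff_neq0 mcoeffB mcoeffZ mcoeffU.
by rewrite (eq_sym (lead_word a g b)) (negbTE ne) mulr0n mulr0 subr0 mcoeff_neq0 Lw_supp.
Qed.

End Lrep.

Definition anyw : W -> Prop := fun=> True.

Lemma lrep_sandwich_any GG a b f :
  lrep GG anyw f -> lrep GG anyw (sandwich a f b).
Proof. exact: lrep_sandwich. Qed.

Lemma lrep_mul_any GG f p q : lrep GG anyw f -> lrep GG anyw (p * f * q).
Proof.
move=> If; rewrite malg_sandwich_sum; apply: lrep_sum => u _.
by apply: lrep_sum => v _; apply: lrepZ; exact: lrep_sandwich_any.
Qed.

Lemma ideal_genE (S : set A) f : ideal_gen S f <-> lrep S anyw f.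
Proof.
split=> [[t tS ->]|].
  apply: lrep_sum => -[[p g] q] /tS /= Sg; apply: lrep_mul_any.
  by rewrite -[g]sandwich1; apply: lrep_sandwich1.
elim=> [|c a g b {}f Sg _ _ [t tS ->]]; first by exists [::]; rewrite ?big_nil.
exists ((c *: << a >>, g, << b >>) :: t) => [x|].
  by rewrite inE => /orP[/eqP ->|/tS].
by rewrite big_cons /= -!fgscaleAl.
Qed.

Lemma lrep_gen (S T : set A) P f : (forall g, S g -> lrep T anyw g) ->
  lrep S P f -> lrep T anyw f.
Proof.
move=> ST; elim=> [|c a g b {}f Sg _ _ IH]; first exact: lrep0.
by apply: lrepD => //; apply: lrepZ; apply: lrep_sandwich_any; exact: ST.
Qed.

Lemma ideal_lead_supp (S : set A) f w :
  ideal_gen [set << Lw g >> | g in S `\ 0] f -> w \in msupp f ->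
  exists g a b, [/\ S g, g != 0 & w = lead_word a g b].
Proof.
move=> /ideal_genE; elim=> [|c a _ b {}f [g [Sg g0] <-] _ _ IH].
  by rewrite msupp0 inE.
move=> /(fsubsetP (msuppD_le _ _)); rewrite inE => /orP[|/IH //].
move=> /(fsubsetP (msuppZ_le _ _)); rewrite sandwichU msuppU1 inE => /eqP ->.
by exists g, a, b; split=> //; exact/eqP.
Qed.

Lemma ideal_lead_word (S : set A) a g b : S g -> g != 0 ->
  ideal_gen [set << Lw g >> | g in S `\ 0] (<< lead_word a g b >> : A).
Proof.
move=> Sg g0; apply/ideal_genE; rewrite -sandwichU; apply: lrep_sandwich1 => //.
by exists g => //; split=> //; exact/eqP.
Qed.

(** An ideal generated by words contains a word only if a generator divides it, so equality of the
    two leading ideals amounts to divisibility of leading words. *)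
Lemma groebner_basisP (S GG : set A) :
  groebner_basis sigma (ideal_gen S) GG <->
  GG `<=` ideal_gen S /\
  forall f, ideal_gen S f -> f != 0 ->
    exists g a b, [/\ GG g, g != 0 & Lw f = lead_word a g b].
Proof.
split=> [[GS eG]|[GS h]]; split=> //.
  move=> f Sf f0; apply: (@ideal_lead_supp _ (<< Lw f >> : A)).
    rewrite eG -[Lw f]mulm1 -[Lw f]mul1m; exact: ideal_lead_word.
  by rewrite msuppU1 inE.
apply/seteqP; split=> f /ideal_genE ff; apply/ideal_genE; apply: lrep_gen ff.
  move=> _ [g [Gg /eqP g0] <-]; apply/ideal_genE.
  by rewrite -[Lw g]mulm1 -[Lw g]mul1m; apply: ideal_lead_word => //; exact: GS.
move=> _ [g [Ig /eqP g0] <-]; apply/ideal_genE.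
by have [g' [a [b [Gg' g'0 ->]]]] := h g Ig g0; exact: ideal_lead_word.
Qed.

(** Each reduction subtracts a multiple whose leading word is that of the current [v], hence within
    the downward closed [P]. Moving a leading monomial leaves [v + p] unchanged. *)
Lemma division_lrep (G : seq A) GG (P : W -> Prop) (v p r : A) :
    (forall u u', sigma u u' -> P u' -> P u) ->
    0 \notin G -> (forall g, g \in G -> GG g) ->
    division sigma G v p r -> within P v ->
  lrep GG P (v + p - r) /\ (within P p -> within P r).
Proof.
move=> Pdown G0 GGG.
elim=> {v p r} [p|v p r i w w' v0 iG vE _ _ IH|v p r v0 _ _ IH] Pv.
- by split=> //; rewrite add0r subrr; exact: lrep0.
- have Gi : G`_i \in G by exact: mem_nth.
  have Pvi : P (lead_word w G`_i w') by rewrite /lead_word -vE; apply/Pv/Lw_supp.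
  set c := Lc v / Lc G`_i in IH; set q := sandwich w G`_i w'.
  have [|IH1 IH2] := IH.
    by apply: withinB => //; apply: withinZ; exact: within_sandwich_Lw.
  split=> //; have -> : v + p - r = c *: q + (v - c *: q + p - r).
    by rewrite -!addrA [RHS]addrCA addNKr.
  by apply: lrepS => //; exact: GGG.
- have [|IH1 IH2] := IH.
    by apply: withinB => //; apply: withinZ; apply: withinU; apply/Pv/Lw_supp.
  split; first by move: IH1; rewrite (addrC p) addrA subrK.
  move=> Pp; apply: IH2; apply: withinD => //; apply: withinZ; apply: withinU.
  by apply/Pv/Lw_supp.
Qed.

Lemma division_normal (G : seq A) (v p r : A) : division sigma G v p r ->
  let normal u := forall k a b, (k < size G)%N -> u <> lead_word a G`_k b in
  within normal p -> within normal r.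
Proof.
move=> d normal; elim: d => // {}v {}p {}r v0 h _ IH np.
apply: IH; apply: withinD => //; apply: withinZ; apply: withinU.
by move=> k a b kG; exact: h.
Qed.

Lemma lrep_disjoint GG a g b h d : GG g -> GG h -> g != 0 -> h != 0 ->
  lrep GG (slt^~ (lead_word a g (b * Lw h * d)%M))
    (monic_term a g (b * Lw h * d)%M - monic_term (a * Lw g * b)%M h d).
Proof.
move=> Gg Gh g0 h0.
have hat_below f : f != 0 -> below (Lw f) ((Lc f)^-1 *: f - << Lw f >>).
  move=> f0; have := @below_monic_term mone f mone f0.
  by rewrite /monic_term /lead_word sandwich1 mul1m mulm1.
rewrite /monic_term -!sandwichZ sandwich_exchange; apply: lrepB.
  rewrite malg_mul_sum; apply: lrep_sum => u /(hat_below _ g0) ug.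
  rewrite sandwich_wordl sandwichZ; do 2 apply: lrepZ.
  apply: lrep_sandwich1 => //.
  have -> : lead_word (a * u * b)%M h d = (a * u * (b * Lw h * d))%M.
    by rewrite /lead_word !mulmA.
  exact: slt_mul.
rewrite malg_mul_sum; apply: lrep_sum => u /(hat_below _ h0) uh.
rewrite sandwich_wordr sandwichZ; do 2 apply: lrepZ.
apply: lrep_sandwich1 => //.
have cE v : lead_word a g (b * v * d)%M = (a * Lw g * b * v * d)%M.
  by rewrite /lead_word !mulmA.
by rewrite !cE; exact: slt_mul.
Qed.

End Representations.

(** * Obstructions and their reduction to nontrivial ones *)

Lemma mem_msupp_binomial (T : choiceType) (K : fieldType) (p q : K) (x y : T) :
    p != 0 -> q != 0 -> x != y ->
  msupp (p *: << x >> - q *: << y >>) =i [:: x; y].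
Proof.
move=> p0 q0 xy z; rewrite -mcoeff_neq0 mcoeffB !mcoeffZ !mcoeffU !inE.
rewrite (eq_sym z x) (eq_sym z y).
have [<-|_] := eqVneq x z.
  by rewrite (eq_sym y x) (negbTE xy) mulr1 mulr0 subr0 p0.
rewrite mulr0 sub0r oppr_eq0.
have [_|_] := eqVneq y z; first by rewrite mulr1 q0.
by rewrite mulr0 eqxx.
Qed.

Section Obstructions.

Variables (K : fieldType) (n : nat) (sigma : word_ordering n).
Local Notation A := (freealg K n).
Local Notation F := (freebimod K n).
Local Notation W := (word n).
Local Notation Lw := (Lw sigma).
Local Notation Lc := (Lc sigma).
Local Notation lead_word := (lead_word sigma).
Local Notation monic_term := (monic_term sigma).
Local Notation is_obs := (is_obs sigma).
Local Notation obs := (obs sigma).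
Local Notation Spoly := (Spoly sigma).
Local Notation nontrivial := (nontrivial sigma).
Implicit Types (G : seq A) (i j k : nat) (a b c d u v w : W) (GG : set A).

Lemma nth_neq0 G i : 0 \notin G -> (i < size G)%N -> G`_i != 0.
Proof. by move=> G0 iG; apply: contraNneq G0 => <-; exact: mem_nth. Qed.

(** Equal triples would carry equal coefficients and cancel. The support thus recovers the indices
    and words from a bare element of the bimodule. *)
Lemma mem_obs G i j a b a' b' : 0 \notin G -> is_obs G i j a b a' b' ->
  (a, i, b) != (a', j, b') /\
  msupp (obs G i j a b a' b') =i [:: (a, i, b); (a', j, b')].
Proof.
move=> G0 [iG jG _ o0]; have ne : (a, i, b) != (a', j, b').
  by apply: contraNneq o0 => -[-> -> ->]; rewrite /obs subrr.
split=> [|k]; first exact: ne.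
by apply: mem_msupp_binomial => //; rewrite invr_eq0 Lc_neq0 // nth_neq0.
Qed.

Lemma is_obsI G i j a b a' b' : 0 \notin G -> (i < size G)%N -> (j < size G)%N ->
    lead_word a G`_i b = lead_word a' G`_j b' -> (a, i, b) != (a', j, b') ->
  is_obs G i j a b a' b'.
Proof.
move=> G0 iG jG e ne; split; [exact: iG|exact: jG|exact: e|].
have c0 k : (k < size G)%N -> (Lc G`_k)^-1 != 0.
  by move=> kG; rewrite invr_eq0 Lc_neq0 // nth_neq0.
have := mem_msupp_binomial (c0 _ iG) (c0 _ jG) ne (a, i, b).
rewrite inE eqxx; apply: contraTneq => o0.
by rewrite -[X in msupp X]/(obs G i j a b a' b') o0 msupp0 inE.
Qed.

Lemma is_obs_sym G i j a b a' b' : 0 \notin G -> is_obs G i j a b a' b' ->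
  is_obs G j i a' b' a b.
Proof.
move=> G0 o; have [ne _] := mem_obs G0 o; have [iG jG e _] := o.
by apply: is_obsI; rewrite // eq_sym.
Qed.

(** [GG] may exceed [G]: a representation may use polynomials appended later. *)
Definition obs_lrep GG G i j a b a' b' : Prop :=
  lrep sigma GG (slt sigma ^~ (lead_word a G`_i b)) (Spoly G i j a b a' b').

Lemma obs_lrep_refl GG G i a b : obs_lrep GG G i i a b a b.
Proof. by rewrite /obs_lrep /Spoly subrr; exact: lrep0. Qed.

Lemma obs_lrep_sym GG G i j a b a' b' : lead_word a G`_i b = lead_word a' G`_j b' ->
  obs_lrep GG G i j a b a' b' -> obs_lrep GG G j i a' b' a b.
Proof.
by rewrite /obs_lrep => <- /lrepN; rewrite /Spoly opprB.
Qed.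

Lemma obs_lrep_trans GG G i j k a b a' b' a'' b'' :
    lead_word a G`_i b = lead_word a' G`_j b' ->
    obs_lrep GG G i j a b a' b' -> obs_lrep GG G j k a' b' a'' b'' ->
  obs_lrep GG G i k a b a'' b''.
Proof.
rewrite /obs_lrep => <- h h'; have := lrepD h h'.
by rewrite /Spoly addrA subrK.
Qed.

Lemma obs_lrep_sandwich GG G i j a b a' b' c d :
    obs_lrep GG G i j a b a' b' ->
  obs_lrep GG G i j (c * a)%M (b * d)%M (c * a')%M (b' * d)%M.
Proof.
move=> h; rewrite /obs_lrep.
have -> : Spoly G i j (c * a)%M (b * d)%M (c * a')%M (b' * d)%M =
    sandwich c (Spoly G i j a b a' b') d.
  rewrite sandwichB; congr (_ - _); exact: monic_term_sandwich.
apply: lrep_sandwich h => u; rewrite lead_word_sandwich; exact: slt_mul.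
Qed.

(* The support of an obstruction determines it up to sign. *)
Lemma obs_lrep_supp GG G i j a b a' b' i0 j0 a0 b0 a0' b0' :
    is_obs G i0 j0 a0 b0 a0' b0' -> obs_lrep GG G i0 j0 a0 b0 a0' b0' ->
    (a, i, b) \in [:: (a0, i0, b0); (a0', j0, b0')] ->
    (a', j, b') \in [:: (a0, i0, b0); (a0', j0, b0')] ->
  (a, i, b) != (a', j, b') -> obs_lrep GG G i j a b a' b'.
Proof.
move=> [_ _ e _] h; rewrite !inE.
case/orP => /eqP[-> -> ->]; case/orP => /eqP[-> -> ->].
- by move=> /eqP ne; case: ne.
- by move=> _; exact: h.
- by move=> _; exact: obs_lrep_sym h.
- by move=> /eqP ne; case: ne.
Qed.

(** Equal terms and disjoint occurrences are representable outright. Otherwise, cancelling the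
    shorter left cofactor and the common right one leaves one of the nontrivial forms, up to the
    order of the two polynomials. *)
Lemma obs_lrep_reduce GG G i j a b a' b' : 0 \notin G ->
    (forall g, g \in G -> GG g) -> (forall g, g \in G -> Lw g != mone) ->
    (i < size G)%N -> (j < size G)%N -> lead_word a G`_i b = lead_word a' G`_j b' ->
    (fdeg a <= fdeg a')%N ->
  obs_lrep GG G i j a b a' b' \/ exists c d a0 b0 a0' b0',
    [/\ a = (c * a0)%M, b = (b0 * d)%M, a' = (c * a0')%M, b' = (b0' * d)%M &
      (i <= j)%N /\ nontrivial G i j a0 b0 a0' b0' \/
      (j <= i)%N /\ nontrivial G j i a0' b0' a0 b0].
Proof.
move=> G0 GGG G1 iG jG e le.
have [[aa' -> bb']|ne] := eqVneq (a, i, b) (a', j, b').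
  by left; rewrite aa' bb'; exact: obs_lrep_refl.
have [Gi Gj] : G`_i \in G /\ G`_j \in G by split; exact: mem_nth.
move: (e); rewrite /lead_word -!mulmA => e1.
have [p ea' eb] := mmul_prefix e1 le.
have [disj|ov] := leqP (fdeg (Lw G`_i)) (fdeg p).
  left; have [m pE bE] := mmul_prefix eb disj.
  rewrite ea' pE bE mulmA; rewrite (mulmA m).
  apply: lrep_disjoint; [exact: GGG|exact: GGG| |]; exact: nth_neq0.
right; rewrite mulmA in eb.
have [d [b0 [b0' [bE b'E b01]]]] := suffix_reduce eb.
exists a, d, mone, b0, p, b0'.
have e0 : (mone * Lw G`_i * b0 = p * Lw G`_j * b0')%M.
  by rewrite mul1m; apply: (@mmulIr _ d); rewrite -!mulmA -bE -b'E mulmA.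
have ne0 : (mone, i, b0) != (p, j, b0').
  by apply: contraNneq ne => -[p1 -> b00]; rewrite ea' bE b'E -p1 -b00 mulm1 eqxx.
have o : is_obs G i j mone b0 p b0' by exact: is_obsI.
have deg1 : fdeg (mone : W) = 0%N by exact: fdeg1.
have Lj0 : (0 < fdeg (Lw G`_j))%N by rewrite lt0n fdeg_eq0 G1.
have ovl : overlap sigma G i j mone p.
  (* The shared position is the first letter of the second leading word, which exists because that
     word is not empty. *)
  by exists (fdeg p); split; rewrite ?deg1 ?leq0n ?add0n ?ov // leqnn -addn1 leq_add2l.
split; [by rewrite mulm1|by []|by []|by []|].
case: (ltngtP i j) => ij; [left|right|left].
- split; [by []|split; [exact: o|exact: ovl|rewrite ltn_eqF //]].
  by case: b01 => ->; [constructor 4|constructor 2].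
- split; [by []|split; [exact: is_obs_sym| |]].
    by case: ovl => q [? ?]; exists q.
  by rewrite ltn_eqF //; case: b01 => ->; [constructor 3|constructor 1].
- split; [by []|split; [exact: o|exact: ovl|rewrite ij eqxx]].
  (* For a self-obstruction, [p] empty would make both triples equal. So [b0] is not empty, and it
     is [b0'] that was stripped completely. *)
  have degE : (fdeg b0 = fdeg p + fdeg b0')%N.
    by move/(congr1 (@fdeg _)): e0; rewrite !fdegM ij deg1; lia.
  have p1 : p != mone.
    apply: contraNneq ne0 => p1; rewrite p1 ij; move: e0; rewrite ij p1 !mul1m.
    by move=> /mmulI ->.
  have b0n1 : b0 != mone.
    by move: p1; rewrite -!fdeg_eq0; move: degE; lia.
  by case: b01 => b01 //; rewrite b01 eqxx in b0n1.
Qed.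

(** * The multiply criterion for a single omitted obstruction *)

Section MultiplyCriterion.

Variables (G : seq A) (GG : set A) (o : F).
Hypothesis G_neq0 : 0 \notin G.
Hypothesis G_sub : forall g, g \in G -> GG g.
Hypothesis G_nonunit : forall g, g \in G -> Lw g != mone.
Hypothesis nontrivial_lrep : forall i j a b a' b', (i <= j)%N ->
  nontrivial G i j a b a' b' -> obs G i j a b a' b' <> o ->
  obs_lrep GG G i j a b a' b'.

(** Only a reduction to [o] escapes [nontrivial_lrep]. Since the reduction may swap the two
    polynomials, this exception is recorded through the support of [o], which ignores sign. *)
Lemma obs_lrep_or_multiple i j a b a' b' : (i < size G)%N -> (j < size G)%N ->
    lead_word a G`_i b = lead_word a' G`_j b' ->
  obs_lrep GG G i j a b a' b' \/ exists c d a0 b0 a0' b0',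
    [/\ [/\ a = (c * a0)%M, b = (b0 * d)%M, a' = (c * a0')%M & b' = (b0' * d)%M],
      is_obs G i j a0 b0 a0' b0', (a0, i, b0) \in msupp o &
      (a0', j, b0') \in msupp o].
Proof.
move=> iG jG e.
wlog le : i j a b a' b' iG jG e / (fdeg a <= fdeg a')%N => [hw|].
  have [le|/ltnW le] := leqP (fdeg a) (fdeg a'); first exact: hw.
  case: (hw j i a' b' a b jG iG (esym e) le) => [h|].
    by left; apply: obs_lrep_sym h; exact: esym.
  move=> [c [d [a0 [b0 [a0' [b0' [[? ? ? ?] ob m1 m2]]]]]]].
  right; exists c, d, a0', b0', a0, b0.
  by split; [|exact: is_obs_sym|exact: m2|exact: m1].
case: (obs_lrep_reduce G_neq0 G_sub G_nonunit iG jG e le) => [|]; first by left.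
move=> [c [d [a0 [b0 [a0' [b0' [-> -> -> -> nt]]]]]]].
case: nt => -[ij nt]; case: (nt) => ob _ _; have [_ mo] := mem_obs G_neq0 ob.
- have [oE|no] := eqVneq (obs G i j a0 b0 a0' b0') o; last first.
    left; apply: obs_lrep_sandwich; apply: nontrivial_lrep => //; exact/eqP.
  right; exists c, d, a0, b0, a0', b0'; rewrite -oE.
  by split; [|exact: ob|rewrite mo mem_head|rewrite mo !inE eqxx orbT].
- have [oE|no] := eqVneq (obs G j i a0' b0' a0 b0) o; last first.
    left; apply: obs_lrep_sandwich.
    have [_ _ e0 _] := ob; apply: (obs_lrep_sym e0).
    by apply: nontrivial_lrep => //; exact/eqP.
  right; exists c, d, a0, b0, a0', b0'; rewrite -oE.
  by split; [|exact: is_obs_sym|rewrite mo !inE eqxx orbT|rewrite mo mem_head].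
Qed.

Variables (i j s : nat) (wi wi' us us' wj wj' vs vs' w w' : W).
Hypothesis o_obs : is_obs G i s wi wi' us us'.
Hypothesis oE : o = obs G i s wi wi' us us'.
Hypothesis j_obs : is_obs G j s wj wj' vs vs'.
Hypothesis j_lrep : obs_lrep GG G j s wj wj' vs vs'.
Hypothesis usE : us = (w * vs)%M.
Hypothesis us'E : us' = (vs' * w')%M.

Lemma mem_o (k : W * nat * W) : (k \in msupp o) = (k \in [:: (wi, i, wi'); (us, s, us')]).
Proof. by rewrite oE; have [_ ->] := mem_obs G_neq0 o_obs. Qed.

(* The obstruction o is the sum of an obstruction of g_i and g_j and of          *)
(* w o_{j,s} w'. The former may be reducible to a nontrivial obstruction, but     *)
(* not to o itself: the two would have the same leading word, hence the same     *)
(* support, which forces o_{j,s} = 0.                                            *)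
Lemma removed_obs_lrep : obs_lrep GG G i s wi wi' us us'.
Proof.
have [iG sG e_is _] := o_obs; have [jG _ e_js _] := j_obs.
have [ne_js _] := mem_obs G_neq0 j_obs.
have e_ms : lead_word (w * wj)%M G`_j (wj' * w')%M = lead_word us G`_s us'.
  by rewrite usE us'E !lead_word_sandwich; congr (_ * _ * _)%M.
have ms_lrep : obs_lrep GG G j s (w * wj)%M (wj' * w')%M us us'.
  by rewrite usE us'E; exact: obs_lrep_sandwich.
have e_im : lead_word wi G`_i wi' = lead_word (w * wj)%M G`_j (wj' * w')%M.
  by rewrite e_ms.
apply: (obs_lrep_trans e_im) ms_lrep.
case: (obs_lrep_or_multiple iG jG e_im) => [h|]; first exact: h.
move=> [c [d [a0 [b0 [a0' [b0' [[ea eb ea' eb'] ob]]]]]]].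
have lw_o a k b : (a, k, b) \in msupp o ->
    lead_word a G`_k b = lead_word wi G`_i wi'.
  by rewrite mem_o !inE => /orP[] /eqP[-> -> ->].
move=> m1 m2.
have [c1 d1] : c = mone /\ d = mone.
  apply: (@fdeg_id_mul _ c (lead_word wi G`_i wi') d).
  by rewrite -{1}(lw_o _ _ _ m1) -lead_word_sandwich -ea -eb.
rewrite c1 mul1m in ea'; rewrite d1 mulm1 in eb'.
move: m2; rewrite mem_o -ea' -eb' !inE.
case/orP => /eqP[e1 e2 e3].
  by rewrite e1 e2 e3; exact: obs_lrep_refl.
move: ne_js; rewrite e2.
move: e1 e3; rewrite usE us'E => /mmulI -> /mmulIr ->.
by move/eqP => ne; case: ne.
Qed.

Lemma obs_lrep_all k l a b a' b' : (k < size G)%N -> (l < size G)%N ->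
    lead_word a G`_k b = lead_word a' G`_l b' ->
  obs_lrep GG G k l a b a' b'.
Proof.
move=> kG lG e; case: (obs_lrep_or_multiple kG lG e) => [h|]; first exact: h.
move=> [c [d [a0 [b0 [a0' [b0' [[-> -> -> ->] ob m1 m2]]]]]]].
apply: obs_lrep_sandwich; have [ne _] := mem_obs G_neq0 ob.
apply: (obs_lrep_supp o_obs removed_obs_lrep _ _ ne); rewrite -mem_o.
  exact: m1.
exact: m2.
Qed.

End MultiplyCriterion.

(** A pass exhibits some indices and words for the selected element, possibly not those with which
    it was queued. *)
Lemma obs_lrep_same G i j a b a' b' k l c d c' d' GG : 0 \notin G ->
    is_obs G i j a b a' b' -> is_obs G k l c d c' d' ->
    obs G i j a b a' b' = obs G k l c d c' d' ->
  obs_lrep GG G k l c d c' d' -> obs_lrep GG G i j a b a' b'.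
Proof.
move=> G0 ob1 ob2 e h; have [ne m1] := mem_obs G0 ob1.
have [_ m2] := mem_obs G0 ob2.
have mm : [:: (a, i, b); (a', j, b')] =i [:: (c, k, d); (c', l, d')].
  by move=> x; rewrite -m1 e m2.
apply: (obs_lrep_supp ob2 h _ _ ne); rewrite -mm; first exact: mem_head.
by rewrite !inE eqxx orbT.
Qed.

Lemma Spoly_below G i j a b a' b' : 0 \notin G -> is_obs G i j a b a' b' ->
  within (slt sigma ^~ (lead_word a G`_i b)) (Spoly G i j a b a' b').
Proof.
move=> G0 [iG jG]; rewrite -!/(lead_word _ _ _) => e _.
have -> : Spoly G i j a b a' b' =
    (monic_term a G`_i b - << lead_word a G`_i b >>) -
    (monic_term a' G`_j b' - << lead_word a' G`_j b' >>).
  by rewrite -e /Spoly opprB addrA subrK.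
apply: withinB; first by apply: below_monic_term; exact: nth_neq0.
by rewrite e; apply: below_monic_term; exact: nth_neq0.
Qed.

(** Division represents the S-polynomial minus [r]; a nonzero [r] is its own one-term
    representation, since its words stay below the common leading word. *)
Lemma is_NR_obs_lrep GG G i j a b a' b' r : 0 \notin G ->
    (forall g, g \in G -> GG g) -> (r != 0 -> GG r) ->
    is_obs G i j a b a' b' -> is_NR sigma G (Spoly G i j a b a' b') r ->
  obs_lrep GG G i j a b a' b'.
Proof.
move=> G0 GGG Gr ob nr; have Sb := Spoly_below G0 ob.
have down u v : sigma u v -> slt sigma v (lead_word a G`_i b) ->
    slt sigma u (lead_word a G`_i b) by exact: le_slt_trans.
have [h1 h2] := division_lrep down G0 GGG nr Sb.
rewrite /obs_lrep -[Spoly _ _ _ _ _ _ _](subrK r); apply: lrepD.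
  by move: h1; rewrite addr0.
have [->|r0] := eqVneq r 0; first exact: lrep0.
rewrite -[r]sandwich1; apply: lrep_sandwich1; first exact: Gr.
rewrite /lead_word mul1m mulm1; apply: h2; [exact: within0|exact: Lw_supp].
Qed.

End Obstructions.

(** * Invariants of a fair execution and finiteness of the queue *)

Section Execution.

Variables (K : fieldType) (n : nat) (sigma : word_ordering n).
Local Notation A := (freealg K n).
Local Notation F := (freebimod K n).
Local Notation W := (word n).
Local Notation Lw := (Lw sigma).
Local Notation is_obs := (is_obs sigma).
Local Notation obs := (obs sigma).
Local Notation Spoly := (Spoly sigma).
Local Notation nontrivial := (nontrivial sigma).
Implicit Types (G l : seq A) (i j k t : nat) (a b c d u v : W) (GG : set A).

Lemma words_finite (m : nat) :
  exists L : seq W, forall u, (fdeg u <= m)%N -> u \in L.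
Proof.
exists (flatten [seq [seq FMonom (tval v) | v : k.-tuple 'I_n]
  | k <- iota 0 m.+1]) => u um.
apply/flatten_mapP; exists (fdeg u); first by rewrite mem_iota add0n ltnS.
apply/mapP; exists (in_tuple u); first by rewrite mem_enum.
by case: u um.
Qed.

(** In every admissible form two cofactors are empty, and the overlap bounds the other two. This
    makes the set of nontrivial obstructions, hence B, finite. *)
Lemma nontrivial_fdeg G i j a b a' b' : nontrivial G i j a b a' b' ->
  let m := (fdeg (Lw G`_i) + fdeg (Lw G`_j))%N in
  [/\ fdeg a <= m, fdeg b <= m, fdeg a' <= m & fdeg b' <= m]%N.
Proof.
move=> [[_ _ e _] [q [/andP[q1 q2] /andP[q3 q4]]]].
have := congr1 (@fdeg _) e; rewrite !fdegM => {}e.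
have d1 : fdeg (mone : W) = 0%N by exact: fdeg1.
case: eqP => _ nt m.
  have [a1 b'1 _ _] := nt; rewrite /m; move: e q1 q2 q3 q4; rewrite a1 b'1 d1 => *.
  by split; lia.
by case: nt => -[x1 y1]; rewrite /m; move: e q1 q2 q3 q4; rewrite x1 y1 d1 => *;
  split; lia.
Qed.

Lemma NTObs_finite G :
  exists L : seq F, forall i j x, NTObs sigma G i j x -> x \in L.
Proof.
pose m := \max_(k < size G) fdeg (Lw G`_k).
have [L LP] := words_finite (m + m).
pose T := [seq (y, z) | y <- [seq (u, k) | u <- L, k <- iota 0 (size G)], z <- L].
pose ob (x y : W * nat * W) := obs G x.1.2 y.1.2 x.1.1 x.2 y.1.1 y.2.
exists [seq ob x y | x <- T, y <- T].
move=> i j _ [a [b [a' [b' [nt ->]]]]].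
have [[iG jG _ _] _ _] := nt.
have le k : (k < size G)%N -> (fdeg (Lw G`_k) <= m)%N.
  by move=> kG; exact: (leq_bigmax (Ordinal kG)).
have [da db da' db'] := nontrivial_fdeg nt.
have dL u : (fdeg u <= fdeg (Lw G`_i) + fdeg (Lw G`_j))%N -> u \in L.
  by move=> ud; apply: LP; apply: leq_trans ud _; exact: leq_add (le _ iG) (le _ jG).
have TP k u v : (k < size G)%N -> u \in L -> v \in L -> (u, k, v) \in T.
  move=> kG uL vL; apply: allpairs_f vL; apply: allpairs_f uL _.
  by rewrite mem_iota.
rewrite -[X in X \in _]/(ob (a, i, b) (a', j, b')); apply: allpairs_f.
  by apply: TP => //; exact: dL.
by apply: TP => //; exact: dL.
Qed.

Section Extension.

Variables (G l : seq A) (i j : nat).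
Hypotheses (iG : (i < size G)%N) (jG : (j < size G)%N).

Lemma nth_ext k : (k < size G)%N -> (G ++ l)`_k = G`_k.
Proof. by move=> kG; rewrite nth_cat kG. Qed.

Lemma obs_ext a b a' b' : obs (G ++ l) i j a b a' b' = obs G i j a b a' b'.
Proof. by rewrite /obs !nth_ext. Qed.

Lemma is_obs_ext a b a' b' :
  is_obs (G ++ l) i j a b a' b' <-> is_obs G i j a b a' b'.
Proof.
rewrite /is_obs obs_ext !nth_ext //; split=> -[h1 h2 h3 h4].
  by split; [exact: iG|exact: jG|exact: h3|exact: h4].
by split; [rewrite size_cat ltn_addr|rewrite size_cat ltn_addr|exact: h3|exact: h4].
Qed.

Lemma nontrivial_ext a b a' b' :
  nontrivial (G ++ l) i j a b a' b' <-> nontrivial G i j a b a' b'.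
Proof.
rewrite /nontrivial /overlap (nth_ext iG) (nth_ext jG).
by split=> -[h1 h2 h3]; split; [exact/is_obs_ext|exact: h2|exact: h3
  |exact/is_obs_ext|exact: h2|exact: h3].
Qed.

Lemma obs_lrep_ext GG a b a' b' :
  obs_lrep sigma GG (G ++ l) i j a b a' b' = obs_lrep sigma GG G i j a b a' b'.
Proof. by rewrite /obs_lrep /Spoly !nth_ext. Qed.

End Extension.

Lemma is_NR_ideal G (S : set A) i j a b a' b' r : 0 \notin G ->
    (forall g, g \in G -> lrep sigma S (@anyw n) g) ->
    is_obs G i j a b a' b' -> is_NR sigma G (Spoly G i j a b a' b') r ->
  lrep sigma S (@anyw n) r.
Proof.
move=> G0 GS [iG jG _ _] nr.
have GG g : g \in G -> [set` G] g by [].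
have [h _] :=
  division_lrep (P := @anyw n) (fun _ _ _ _ => I) G0 GG nr (fun _ _ => I).
have Sp : lrep sigma [set` G] (@anyw n) (Spoly G i j a b a' b').
  by apply: lrepB; apply: lrepZ; apply: lrep_sandwich1 => //; exact: mem_nth.
have -> : r = Spoly G i j a b a' b' - (Spoly G i j a b a' b' + 0 - r).
  by rewrite addr0 opprB addrC subrK.
exact: lrep_gen GS (lrepB Sp h).
Qed.

Variables (G0 : seq A) (st : nat -> state K n) (sel : nat -> F).
Variables (t0 : nat) (o : F).
Hypothesis G0nz : 0 \notin G0.
Hypothesis exec : execution sigma (new_obs_without sigma t0 o) G0 st sel.

Lemma pass_step t : stG (st t.+1) = stG (st t) \/
  exists r i j a b a' b', [/\ r != 0, is_obs (stG (st t)) i j a b a' b',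
    is_NR sigma (stG (st t)) (Spoly (stG (st t)) i j a b a' b') r,
    stG (st t.+1) = rcons (stG (st t)) r &
    stB (st t.+1) = (stB (st t) `\ sel t) `|`
      new_obs_without sigma t0 o t (rcons (stG (st t)) r)].
Proof.
case: (exec.2 t) => [[_ ->]|]; first by left.
move=> [_ [i [j [a [b [a' [b' [r [ob _ nr ->]]]]]]]]].
have [_|r0] := eqVneq r 0; first by left.
by right; exists r, i, j, a, b, a', b'.
Qed.

Lemma pass_invariant t : 0 \notin stG (st t) /\
  forall g, g \in stG (st t) -> lrep sigma [set` G0] (@anyw n) g.
Proof.
elim: t => [|t [IH1 IH2]].
  rewrite exec.1; split=> [|g gG0]; first exact: G0nz.
  by rewrite -[g]sandwich1; exact: lrep_sandwich1.
case: (pass_step t) => [->//|[r [i [j [a [b [a' [b' [r0 ob nr -> _]]]]]]]]].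
split; first by rewrite mem_rcons inE negb_or eq_sym r0 IH1.
move=> g; rewrite mem_rcons inE => /orP[/eqP ->|]; last exact: IH2.
exact: is_NR_ideal ob nr.
Qed.

Lemma stG_neq0 t : 0 \notin stG (st t).
Proof. by case: (pass_invariant t). Qed.

Lemma stG_extends t t' : (t <= t')%N -> exists l, stG (st t') = stG (st t) ++ l.
Proof.
move=> /subnKC <-; elim: (t' - t)%N => [|m [l IH]].
  by exists [::]; rewrite addn0 cats0.
rewrite addnS; case: (pass_step (t + m)) => [->|]; first by exists l.
move=> [r [? [? [? [? [? [? [_ _ _ -> _]]]]]]]].
by exists (rcons l r); rewrite IH rcons_cat.
Qed.

Lemma stG_sub t t' g : (t <= t')%N -> g \in stG (st t) -> g \in stG (st t').
Proof. by move=> /stG_extends[l ->] gt; rewrite mem_cat gt. Qed.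

Lemma mem_enumerated t g : g \in stG (st t) -> enumerated st g.
Proof. by exists t. Qed.

Lemma stB_finite t : exists L : seq F, forall x, stB (st t) x -> x \in L.
Proof.
elim: t => [|t [L IH]].
  have [L LP] := NTObs_finite G0; exists L; rewrite exec.1 => x.
  by move=> [i [j [_ h]]]; exact: LP h.
case: (exec.2 t) => [[_ ->]|]; first by exists L.
move=> [_ [i [j [a [b [a' [b' [r [_ _ _ ->]]]]]]]]].
case: (r == 0); first by exists L => x [/IH].
have [L' L'P] := NTObs_finite (rcons (stG (st t)) r).
exists (L ++ L') => x; rewrite mem_cat => -[[/IH -> //]|].
have new : new_obs sigma (rcons (stG (st t)) r) x -> (x \in L) || (x \in L').
  by move=> [k _ h]; rewrite (L'P _ _ _ h) orbT.
by rewrite /= /new_obs_without; case: (t == t0) => [[/new]|/new].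
Qed.

(** If [j] is the newest index, the obstruction is among those created in that pass; otherwise it
    was already nontrivial at the previous stage, as [G] only grows at its end. *)
Lemma NTObs_queued t i j x : (i <= j)%N -> (j < size (stG (st t)))%N ->
  NTObs sigma (stG (st t)) i j x -> x = o \/ exists t', stB (st t') x.
Proof.
elim: t => [|t IH] ij jG nt.
  right; exists 0%N; rewrite exec.1; exists i, j; move: jG nt; rewrite exec.1 => jG nt.
  by split; [rewrite ij|exact: nt].
case: (pass_step t) => [e|]; first by rewrite e in jG nt; exact: IH.
move=> [r [? [? [? [? [? [? [_ _ _ eG eB]]]]]]]].
move: jG nt; rewrite eG size_rcons ltnS leq_eqVlt => /orP[/eqP jE|jG] nt; last first.
  apply: (IH ij jG); move: nt => [a [b [a' [b' [nt ->]]]]].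
  have iG := leq_ltn_trans ij jG; move: nt; rewrite -cats1 => nt.
  exists a, b, a', b'; split; last exact: obs_ext.
  by move: nt => /(nontrivial_ext _ iG jG).
have [->|xo] := eqVneq x o; [by left|right].
exists t.+1; rewrite eB; right.
have new : new_obs sigma (rcons (stG (st t)) r) x.
  by exists i; rewrite size_rcons ?ltnS -?jE //.
rewrite /new_obs_without; case: (t == t0) => //; split=> //; exact/eqP.
Qed.

Hypothesis fair_sel : fair st sel.

Lemma stB_obs_lrep t1 t i j a b a' b' :
  stB (st t1) (obs (stG (st t)) i j a b a' b') ->
  is_obs (stG (st t)) i j a b a' b' ->
  obs_lrep sigma (enumerated st) (stG (st t)) i j a b a' b'.
Proof.
move=> Bu ob; have [t' ut' [Bt' selE]] := fair_sel Bu.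
case: (exec.2 t') => [[B0 _]|]; first by rewrite B0 in Bt'.
move=> [_ [i' [j' [c [d [c' [d' [r [ob' oE nr stE]]]]]]]]].
have h' : obs_lrep sigma (enumerated st) (stG (st t')) i' j' c d c' d'.
  apply: is_NR_obs_lrep ob' nr; first exact: stG_neq0.
    by move=> g; exact: mem_enumerated.
  move=> r0; apply: (@mem_enumerated t'.+1).
  by rewrite stE (negbTE r0) mem_rcons mem_head.
have [l lE] := stG_extends (leq_maxl t t').
(* The obstruction as given at [t] and as selected at [t'] are compared at a stage extending
   both. *)
have [l' l'E] := stG_extends (leq_maxr t t').
have [iG jG _ _] := ob; have [i'G j'G _ _] := ob'.
rewrite -(obs_lrep_ext l iG jG) -lE.
apply: (@obs_lrep_same _ _ _ _ i j a b a' b' i' j' c d c' d').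
- exact: stG_neq0.
- by rewrite lE; exact/(is_obs_ext l iG jG).
- by rewrite l'E; exact/(is_obs_ext l' i'G j'G).
- by rewrite {1}lE l'E (obs_ext l iG jG) (obs_ext l' i'G j'G) -selE.
- by rewrite l'E (obs_lrep_ext l' i'G j'G).
Qed.

Lemma nontrivial_obs_lrep t i j a b a' b' : (i <= j)%N ->
    nontrivial (stG (st t)) i j a b a' b' ->
    obs (stG (st t)) i j a b a' b' <> o ->
  obs_lrep sigma (enumerated st) (stG (st t)) i j a b a' b'.
Proof.
move=> ij nt xo; have [ob _ _] := nt; have [_ jG _ _] := ob.
case: (@NTObs_queued t i j (obs (stG (st t)) i j a b a' b') ij jG) => //.
  by exists a, b, a', b'.
by move=> [u Bu]; exact: stB_obs_lrep Bu ob.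
Qed.

Lemma enumerated_ideal g : enumerated st g -> ideal_gen [set` G0] g.
Proof.
by move=> [t gt]; apply/(ideal_genE sigma); exact: (pass_invariant t).2 _ gt.
Qed.

Lemma ideal_enumerated f : ideal_gen [set` G0] f ->
  lrep sigma (enumerated st) (@anyw n) f.
Proof.
move=> /(ideal_genE sigma); apply: lrep_gen => g gG0.
rewrite -[g]sandwich1; apply: lrep_sandwich1 => //.
by exists 0%N; rewrite exec.1.
Qed.

Lemma enumerated_neq0 g : enumerated st g -> g != 0.
Proof. by move=> [t gt]; apply: contraNneq (stG_neq0 t) => <-. Qed.

(** * The enumerated set is a Groebner basis despite the omission *)

Section Removal.

Variables (s i j : nat) (wi wi' us us' wj wj' vs vs' w w' : W).
Hypothesis G_size : size (stG (st t0.+1)) = s.+1.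
Hypothesis i_nontrivial : nontrivial (stG (st t0.+1)) i s wi wi' us us'.
Hypothesis j_nontrivial : nontrivial (stG (st t0.+1)) j s wj wj' vs vs'.
Hypothesis oE : o = obs (stG (st t0.+1)) i s wi wi' us us'.
Hypothesis o_distinct : o <> obs (stG (st t0.+1)) j s wj wj' vs vs'.
Hypothesis usE : us = (w * vs)%M.
Hypothesis us'E : us' = (vs' * w')%M.

Lemma enumerated_spoly a g b a' h b' :
    (forall g, enumerated st g -> Lw g != mone) ->
    enumerated st g -> enumerated st h ->
    lead_word sigma a g b = lead_word sigma a' h b' ->
  lrep sigma (enumerated st) (slt sigma ^~ (lead_word sigma a g b))
    (monic_term sigma a g b - monic_term sigma a' h b').
Proof.
move=> nonunit [t1 g1] [t2 h2] e.
(* A stage containing [g], [h] and all polynomials of the criterion, so that [o] and o_{j,s} are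
   still available. *)
pose T := maxn t0.+1 (maxn t1 t2).
have gT : g \in stG (st T).
  by apply: stG_sub g1; rewrite leq_max leq_maxl orbT.
have hT : h \in stG (st T).
  by apply: stG_sub h2; rewrite leq_max leq_maxr !orbT.
have [l lE] := stG_extends (leq_maxl t0.+1 (maxn t1 t2)); rewrite -/T in lE.
have [io _ _] := i_nontrivial; have [jo _ _] := j_nontrivial.
have [iG sG _ _] := io; have [jG _ _ _] := jo.
have js : (j <= s)%N by rewrite -ltnS -G_size.
have kG : (index g (stG (st T)) < size (stG (st T)))%N by rewrite index_mem.
have lG : (index h (stG (st T)) < size (stG (st T)))%N by rewrite index_mem.
have j_lrep : obs_lrep sigma (enumerated st) (stG (st T)) j s wj wj' vs vs'.
  rewrite lE (obs_lrep_ext l jG sG).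
  by apply: (nontrivial_obs_lrep js j_nontrivial) => /esym; exact: o_distinct.
have oET : o = obs (stG (st T)) i s wi wi' us us'.
  by rewrite lE (obs_ext l iG sG).
have ioT : is_obs (stG (st T)) i s wi wi' us us'.
  by rewrite lE; exact/(is_obs_ext l iG sG).
have joT : is_obs (stG (st T)) j s wj wj' vs vs'.
  by rewrite lE; exact/(is_obs_ext l jG sG).
have := @obs_lrep_all _ _ _ _ _ o (stG_neq0 T) (@mem_enumerated T)
  (fun g gG => nonunit g (mem_enumerated gG)) (@nontrivial_obs_lrep T)
  _ _ _ _ _ _ _ _ _ _ _ _ _ ioT oET joT j_lrep usE us'E
  _ _ a b a' b' kG lG.
rewrite /obs_lrep /Defs.Spoly (nth_index 0 gT) (nth_index 0 hT) => all_ab.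
exact: all_ab e.
Qed.

Lemma enumerated_groebner :
  groebner_basis sigma (ideal_gen [set` G0]) (enumerated st).
Proof.
apply/groebner_basisP; split=> [g|f If f0]; first exact: enumerated_ideal.
(* An empty leading word overlaps nothing, so the reduction to nontrivial obstructions excludes it;
   but it divides every word, which settles this case directly. *)
have [[g [Gg g1]]|nonunit] := pselect (exists g, enumerated st g /\ Lw g = mone).
  exists g, (Lw f), mone; split; [exact: Gg|exact: enumerated_neq0|].
  by rewrite /lead_word g1 !mulm1.
have [|||g Gg [a [b lwE]]] :=
  @lrep_Lw_divides _ _ sigma (enumerated st) _ _ (@anyw n) f f0.
- exact: enumerated_neq0.
- move=> a g b a' h b' Gg Gh e; apply: (enumerated_spoly _ Gg Gh e) => k Gk.
  by apply/eqP => k1; apply: nonunit; exists k; split; [exact: Gk|exact: k1].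
- exact: ideal_enumerated.
by exists g, a, b; split; [exact: Gg|exact: enumerated_neq0|exact: lwE].
Qed.

End Removal.

(* Only finitely many enumerated polynomials are needed for the leading words *)
(* of a finite Groebner basis H, so they are all in G from some pass on.       *)
Lemma stG_groebner (H : seq A) :
    groebner_basis sigma (ideal_gen [set` G0]) (enumerated st) ->
    groebner_basis sigma (ideal_gen [set` G0]) [set` H] ->
  exists t, groebner_basis sigma (ideal_gen [set` G0]) [set` stG (st t)].
Proof.
move=> /groebner_basisP[_ gb] /groebner_basisP[HI gbH].
have [t tH] : exists t, forall h, h \in H -> h != 0 -> exists g a b,
    [/\ g \in stG (st t), g != 0 & Lw h = lead_word sigma a g b].
  have : {subset H <= H} by [].
  elim: {-2}H => [|h s IH] sH; first by exists 0%N.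
  have [|t IHt] := IH; first by move=> x xs; apply: sH; rewrite inE xs orbT.
  have [h0|h0] := eqVneq h 0.
    by exists t => k; rewrite inE => /orP[/eqP ->|]; [rewrite h0 eqxx|exact: IHt].
  have Ih : ideal_gen [set` G0] h by apply: HI; apply: sH; exact: mem_head.
  have [g [a [b [[t' gt'] g0 hE]]]] := gb h Ih h0.
  exists (maxn t t') => k; rewrite inE => /orP[/eqP -> _|ks k0].
    exists g, a, b; split; [|exact: g0|exact: hE].
    exact: stG_sub (leq_maxr t t') gt'.
  have [g' [c [d [g't g'0 kE]]]] := IHt k ks k0.
  exists g', c, d; split; [|exact: g'0|exact: kE].
  exact: stG_sub (leq_maxl t t') g't.
exists t; apply/groebner_basisP; split=> [g gt|f If f0].
  exact: enumerated_ideal (mem_enumerated gt).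
have [h [a [b [hH h0 fE]]]] := gbH f If f0.
have [g [c [d [gt g0 hE]]]] := tH h hH h0.
exists g, (a * c)%M, (d * b)%M; split; [exact: gt|exact: g0|].
by rewrite lead_word_sandwich -hE.
Qed.

(** A nonzero normal remainder would lie in the ideal with a leading word that no leading word of
    [G] divides. So from here on [G] is constant and each pass deletes an element from a finite
    B. *)
Lemma groebner_stop t :
    groebner_basis sigma (ideal_gen [set` G0]) [set` stG (st t)] ->
  exists t', stB (st t') = set0 /\
    groebner_basis sigma (ideal_gen [set` G0]) [set` stG (st t')].
Proof.
have [L LP] := stB_finite t.
have [m] := ubnP (size L); elim: m => // m IH in t L LP *.
rewrite ltnS => Lm gb.
case: (exec.2 t) => [[B0 _]|]; first by exists t.
move=> [Bx [i [j [a [b [a' [b' [r [ob _ nr stE]]]]]]]]].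
have Ir := is_NR_ideal (stG_neq0 t) (pass_invariant t).2 ob nr.
have r0 : r = 0.
  apply/eqP; apply/negPn/negP => r0; move/groebner_basisP: gb => [_ gb].
  have /(ideal_genE sigma) Ir' := Ir.
  have [g [c [d [gt _ rE]]]] := gb r Ir' r0.
  have := division_normal nr (@within0 _ _ _) (Lw_supp sigma r0).
  move=> /(_ (index g (stG (st t))) c d); rewrite index_mem nth_index // => h.
  by apply: (h gt); exact: rE.
move: stE; rewrite r0 eqxx => stE.
apply: (IH t.+1 (rem (sel t) L)); rewrite ?stE //=.
  move=> x [Bx' /eqP xsel]; have := LP x Bx'.
  by rewrite (perm_mem (perm_to_rem (LP _ Bx))) inE (negbTE xsel).
rewrite size_rem ?LP //; apply: leq_trans Lm.
by rewrite ltn_predL; have := LP _ Bx; case: (L).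
Qed.

End Execution.

Theorem proposition3p6 (K : fieldType) (n : nat) (sigma : word_ordering n)
    (* the input of the procedure *)
    (G0 : seq (freealg K n)) (hG0 : (1 <= size G0)%N) (hG0nz : 0 \notin G0)
    (* a fair execution in which o is left out in pass t0 *)
    (st : nat -> state K n) (sel : nat -> freebimod K n)
    (t0 : nat) (o : freebimod K n)
    (hexec : execution sigma (new_obs_without sigma t0 o) G0 st sel)
    (hfair : fair st sel)
    (* a new element is appended in pass t0, resulting in G = {g_0, ..., g_s} *)
    (G : seq (freealg K n)) (s : nat) (hG : stG (st t0.+1) = G)
    (hs : size (stG (st t0)) = s) (hGs : size G = s.+1)
    (i j : nat) (wi wi' us us' wj wj' vs vs' w w' : word n)
    (hi : nontrivial sigma G i s wi wi' us us')
    (hj : nontrivial sigma G j s wj wj' vs vs')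
    (ho : o = obs sigma G i s wi wi' us us')
    (hdistinct : o <> obs sigma G j s wj wj' vs vs')
    (hu : us = (w * vs)%M) (hu' : us' = (vs' * w')%M)
    (hww' : (w * w')%M <> mone) :
  let I := ideal_gen [set` G0] in
  groebner_basis sigma I (enumerated st) /\
  ((exists H : seq (freealg K n), groebner_basis sigma I [set` H]) ->
   exists t : nat, stB (st t) = set0 /\
                   groebner_basis sigma I [set` stG (st t)]).
Proof.
move: hi hj ho hdistinct hGs; rewrite -hG => hi' hj' ho' hd' hGs' I.
have gb : groebner_basis sigma I (enumerated st).
  exact: (enumerated_groebner hG0nz hexec hfair hGs' hi' hj' ho' hd' hu hu').
split=> [|[H gbH]]; first exact: gb.
have [t gbt] := stG_groebner hG0nz hexec gb gbH.
exact: groebner_stop hG0nz hexec _ gbt.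
Qed.
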